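(* Let $\alpha_1>0$ and $\alpha_2>0$. For $0<\underline{\lambda}<\overline{\lambda}$, let $\underline{f}(x)=f(x;\underline{\lambda})$ and $\overline{f}(x)=f(x;\overline{\lambda})$. Let $0<x_1<x_2<L$ be two consecutive zeros of $\underline{f}$. Then $\overline{f}$ has at least one zero in $[x_1,x_2]$.
   Context: Here $L>0$ and $p,q,r$ are positive and sufficiently regular real functions on $[0,L]$ (regular enough that solutions are classical and the classical results on regularity of solutions of second order linear ODEs with respect to parameters, such as Peano's theorem, apply). $\alpha_1,\alpha_2$ are real constants. For a real parameter $\lambda$, $f(x;\lambda)$ denotes the solution of $$(p(x)f')'-(q(x)-\lambda r(x))f=0\quad (0<x<L),\qquad f'(0)=(\alpha_1\lambda+\alpha_2)f(0),$$ normalized by $f(0;\lambda)=1$ (primes are derivatives in $x$). *)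

(* Defs.v *)
From Stdlib Require Export Reals.
Open Scope R_scope.

Definition cc (a b : R) : R -> Prop := fun x => a <= x <= b.

(* Derivatives and continuity on a closed interval are relative to that
   interval, hence one-sided at the endpoints: the values of the functions
   outside the interval are irrelevant. *)
Definition continuous_on (a b : R) (f : R -> R) : Prop :=
  forall x, cc a b x -> continue_in f (cc a b) x.

Definition derivative_on (a b : R) (f f' : R -> R) : Prop :=
  forall x, cc a b x -> D_in f f' (cc a b) x.

Definition C1_on (a b : R) (f : R -> R) : Prop :=
  exists f', derivative_on a b f f' /\ continuous_on a b f'.

Definition positive_on (a b : R) (f : R -> R) : Prop :=
  forall x, cc a b x -> 0 < f x.

(* [f] is a classical solution of (p f')' - (q - lambda r) f = 0 on (0, L) with
   f'(0) = (alpha1 lambda + alpha2) f(0) and f(0) = 1. *)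
Definition is_solution (L : R) (p q r : R -> R) (alpha1 alpha2 lambda : R)
    (f : R -> R) : Prop :=
  exists f' : R -> R,
    derivative_on 0 L f f' /\ continuous_on 0 L f' /\
    (exists dpf' : R -> R, forall x, 0 < x < L ->
       derivable_pt_lim (fun y => p y * f' y) x (dpf' x) /\
       dpf' x - (q x - lambda * r x) * f x = 0) /\
    f' 0 = (alpha1 * lambda + alpha2) * f 0 /\
    f 0 = 1.

Definition consecutive_zeros (f : R -> R) (x1 x2 : R) : Prop :=
  x1 < x2 /\ f x1 = 0 /\ f x2 = 0 /\ forall x, x1 < x < x2 -> f x <> 0.

(* Main.v *)
Require Import Defs.
From Stdlib Require Import Reals Lra Classical.
Open Scope R_scope.

(** Suppose that [v := f_hi] does not vanish on [[x1, x2]], and let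
    [u := f_lo].  Sturm's argument compares the Wronskian
    [W = v (p u') - u (p v')] at the two zeros of [u], but needs the signs of
    [u] and [v].  Picone's identity removes the sign discussion: the quantity
    [(u / v) W = u (p u') - u^2 (p v') / v] vanishes at both zeros of [u], while
    its derivative is
      [p (u' - u v' / v)^2 + (lambda_hi - lambda_lo) r u^2],
    which is positive strictly between them, where [u] does not vanish.  This
    contradicts the mean value theorem.  The identity is [picone_identity]; the
    comparison that it yields for two general linear equations is
    [sturm_picone_comparison]. *)

(** Both endpoints are excluded, so the relative derivative is taken on a
    neighbourhood of [x] and is an ordinary two-sided one. *)
Lemma derivative_on_interior (a b : R) (f f' : R -> R) (x : R) :
  derivative_on a b f f' -> a < x < b -> derivable_pt_lim f x (f' x).
Proof.
  intros Hf Hx eps Heps.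
  assert (Hcc : cc a b x) by (unfold cc; lra).
  destruct (Hf x Hcc eps Heps) as [d [Hd Hlim]].
  assert (Hm : 0 < Rmin d (Rmin (x - a) (b - x)))
    by (repeat apply Rmin_pos; lra).
  exists (mkposreal _ Hm); simpl; intros h Hh0 Hh.
  pose proof (Rmin_l d (Rmin (x - a) (b - x))).
  pose proof (Rmin_r d (Rmin (x - a) (b - x))).
  pose proof (Rmin_l (x - a) (b - x)).
  pose proof (Rmin_r (x - a) (b - x)).
  assert (Hh' : - Rmin d (Rmin (x - a) (b - x)) < h
                < Rmin d (Rmin (x - a) (b - x))) by (apply Rabs_def2 in Hh; lra).
  specialize (Hlim (x + h)); simpl in Hlim; unfold Rdist in Hlim.
  replace (x + h - x) with h in Hlim by ring.
  apply Hlim; split; [| lra].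
  unfold D_x, cc; split; lra.
Qed.

(** Picone's identity at a point, for the equations [(p u')' = a u] and
    [(p v')' = b v]: the terms containing [p] complete a square.  The fluxes
    [p u'] and [p v'] are separate functions [P] and [Q] because the equations
    differentiate these products, and [u'], [v'] themselves may fail to be
    differentiable. *)
Lemma picone_identity (u v P Q : R -> R) (x du dv p a b : R) :
  derivable_pt_lim u x du -> derivable_pt_lim v x dv ->
  derivable_pt_lim P x (a * u x) -> derivable_pt_lim Q x (b * v x) ->
  P x = p * du -> Q x = p * dv -> v x <> 0 ->
  derivable_pt_lim (fun y => u y * P y - u y * u y * Q y / v y) x
    (p * (du - u x * dv / v x) ^ 2 + (a - b) * u x ^ 2).
Proof.
  intros Hu Hv HP HQ HPx HQx Hvx.
  pose proof (derivable_pt_lim_minus _ _ _ _ _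
    (derivable_pt_lim_mult _ _ _ _ _ Hu HP)
    (derivable_pt_lim_div _ _ _ _ _
      (derivable_pt_lim_mult _ _ _ _ _
        (derivable_pt_lim_mult _ _ _ _ _ Hu Hu) HQ) Hv Hvx)) as HD.
  match type of HD with derivable_pt_lim _ _ ?l =>
    replace (p * (du - u x * dv / v x) ^ 2 + (a - b) * u x ^ 2) with l
  end; [exact HD |].
  unfold mult_fct, Rsqr; rewrite HPx, HQx; field; exact Hvx.
Qed.

(** The Sturm-Picone comparison theorem for a common leading coefficient [p].
    The function of [picone_identity] is zero at [x1] and at [x2], yet its
    derivative is positive in between. *)
Lemma sturm_picone_comparison (u v P Q du dv p a b : R -> R) (x1 x2 : R) :
  x1 < x2 ->
  (forall x, x1 <= x <= x2 -> derivable_pt_lim u x (du x)) ->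
  (forall x, x1 <= x <= x2 -> derivable_pt_lim v x (dv x)) ->
  (forall x, x1 <= x <= x2 -> derivable_pt_lim P x (a x * u x)) ->
  (forall x, x1 <= x <= x2 -> derivable_pt_lim Q x (b x * v x)) ->
  (forall x, x1 <= x <= x2 -> P x = p x * du x) ->
  (forall x, x1 <= x <= x2 -> Q x = p x * dv x) ->
  (forall x, x1 < x < x2 -> 0 <= p x /\ b x < a x) ->
  consecutive_zeros u x1 x2 ->
  ~ (forall x, x1 <= x <= x2 -> v x <> 0).
Proof.
  intros H12 Hu Hv HP HQ HPd HQd Hpos [_ [Hu1 [Hu2 Hu0]]] Hv0.
  destruct (MVT_cor2 (fun y => u y * P y - u y * u y * Q y / v y)
    (fun x => p x * (du x - u x * dv x / v x) ^ 2 + (a x - b x) * u x ^ 2)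
    x1 x2 H12) as [c [Hc Hcin]].
  - intros x Hx; apply picone_identity with (P := P) (Q := Q); auto.
  - cbv beta in Hc; rewrite Hu1, Hu2 in Hc.
    destruct (Hpos c Hcin) as [Hp Hab].
    assert (H1 : 0 <= p c * (du c - u c * dv c / v c) ^ 2)
      by (apply Rmult_le_pos; [exact Hp | apply pow2_ge_0]).
    assert (H2 : 0 < (a c - b c) * u c ^ 2).
    { apply Rmult_lt_0_compat; [lra |].
      rewrite <- Rsqr_pow2; apply Rsqr_pos_lt; auto. }
    assert (H3 : 0 < (p c * (du c - u c * dv c / v c) ^ 2
                      + (a c - b c) * u c ^ 2) * (x2 - x1))
      by (apply Rmult_lt_0_compat; lra).
    rewrite <- Hc in H3; unfold Rdiv in H3; lra.
Qed.

Lemma solution_flux_derivative (L : R) (p q r : R -> R)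
    (alpha1 alpha2 lambda : R) (f : R -> R) :
  is_solution L p q r alpha1 alpha2 lambda f ->
  exists f' : R -> R, forall x, 0 < x < L ->
    derivable_pt_lim f x (f' x) /\
    derivable_pt_lim (fun y => p y * f' y) x ((q x - lambda * r x) * f x).
Proof.
  intros [f' [Hf [_ [[dP HP] _]]]].
  exists f'; intros x Hx; split.
  - exact (derivative_on_interior _ _ _ _ _ Hf Hx).
  - destruct (HP x Hx) as [HdP Heq].
    replace ((q x - lambda * r x) * f x) with (dP x) by lra; exact HdP.
Qed.

Theorem theorem1p2 (L : R) (p q r : R -> R) (alpha1 alpha2 : R)
    (lambda_lo lambda_hi : R) (f_lo f_hi : R -> R) (x1 x2 : R) :
  0 < L ->
  C1_on 0 L p -> continuous_on 0 L q -> continuous_on 0 L r ->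
  positive_on 0 L p -> positive_on 0 L q -> positive_on 0 L r ->
  0 < alpha1 -> 0 < alpha2 ->
  0 < lambda_lo -> lambda_lo < lambda_hi ->
  is_solution L p q r alpha1 alpha2 lambda_lo f_lo ->
  is_solution L p q r alpha1 alpha2 lambda_hi f_hi ->
  0 < x1 -> x1 < x2 -> x2 < L ->
  consecutive_zeros f_lo x1 x2 ->
  exists x, x1 <= x <= x2 /\ f_hi x = 0.
Proof.
  intros _ _ _ _ Hp _ Hr _ _ _ Hlam Hlo Hhi H1 H12 H2 Hzeros.
  destruct (solution_flux_derivative _ _ _ _ _ _ _ _ Hlo) as [du Hu].
  destruct (solution_flux_derivative _ _ _ _ _ _ _ _ Hhi) as [dv Hv].
  apply NNPP; intros Hno.
  apply (sturm_picone_comparison f_lo f_hi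
    (fun y => p y * du y) (fun y => p y * dv y) du dv p
    (fun x => q x - lambda_lo * r x) (fun x => q x - lambda_hi * r x) x1 x2);
    auto.
  1-4: intros x Hx; first [apply Hu | apply Hv]; lra.
  - intros x Hx.
    assert (Hcc : cc 0 L x) by (unfold cc; lra).
    split; [apply Rlt_le, Hp, Hcc |].
    pose proof (Rmult_lt_compat_r _ _ _ (Hr x Hcc) Hlam); lra.
  - intros x Hx Hx0; apply Hno; exists x; auto.
Qed.
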